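(* Let $r\geq 3$ and $1 \leq i \leq j \leq r-2$. If $\mu = -\alpha_{i,j}$, then \[ \vert \mathcal{A}_r(\tilde\alpha, \mu) \vert = \vert \mathcal{A}_{r-1}(\tilde\alpha, \mu) \vert + \vert \mathcal{A}_{r-2}(\tilde\alpha, \mu) \vert. \]
   Context: For each $n\ge 1$, in type $A_n$ (Lie algebra $\mathfrak{sl}_{n+1}(\mathbb{C})$): the simple roots are $\alpha_k=e_k-e_{k+1}\in\mathbb{R}^{n+1}$ for $1\le k\le n$; the positive roots are $\alpha_{i,j}=\alpha_i+\alpha_{i+1}+\cdots+\alpha_j$ for $1\le i\le j\le n$; the highest root is $\tilde\alpha=\alpha_1+\cdots+\alpha_n$; $\rho$ is half the sum of the positive roots; the Weyl group is $W\cong\mathfrak{S}_{n+1}$ permuting $e_1,\dots,e_{n+1}$. $\wp(\xi)$ is the number of ways of expressing $\xi$ as a linear combination of positive roots with nonnegative integer coefficients, and $\mathcal{A}_n(\lambda,\mu)=\{\sigma\in W:\wp(\sigma(\lambda+\rho)-\mu-\rho)>0\}$, the subscript denoting the rank $n$. In each term $\mathcal{A}_n(\tilde\alpha,\mu)$, the symbols $\tilde\alpha$ and $\mu=-(\alpha_i+\cdots+\alpha_j)$ are interpreted in type $A_n$ (with the same indices $i,j$). *)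

(* Defs.v *)
From HB Require Import structures.
From mathcomp Require Import all_boot all_order all_fingroup all_algebra.
From mathcomp Require Import finmap.
From mathcomp Require Import boolp classical_sets functions cardinality reals.

Set Implicit Arguments.
Unset Strict Implicit.
Unset Printing Implicit Defensive.

Import Order.TTheory GRing.Theory Num.Theory.
Local Open Scope ring_scope.

(* Weights of type A_n are row vectors in R^(n+1).  Indices of basis vectors
   and of roots are natural numbers counted from 1; since ordinals count
   from 0, coordinate [m : 'I_n.+1] is coordinate [m.+1] in that numbering. *)

Definition stdvec (R : realType) (n k : nat) : 'rV[R]_n.+1 :=
  \row_(m < n.+1) (m.+1 == k)%:R.

Definition simple_root (R : realType) (n k : nat) : 'rV[R]_n.+1 :=
  stdvec R n k - stdvec R n k.+1.

Definition root_sum (R : realType) (n i j : nat) : 'rV[R]_n.+1 :=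
  \sum_(i <= k < j.+1) simple_root R n k.

Definition highest_root (R : realType) (n : nat) : 'rV[R]_n.+1 :=
  root_sum R n 1 n.

(* The positive roots alpha_(i,j), through their indices 1 <= i <= j <= n. *)
Definition posroot (n : nat) :=
  {p : 'I_n.+1 * 'I_n.+1 | (1 <= p.1 <= p.2)%N}.

Definition posroot_vec (R : realType) (n : nat) (b : posroot n) :
  'rV[R]_n.+1 := root_sum R n (val b).1 (val b).2.

Definition rho (R : realType) (n : nat) : 'rV[R]_n.+1 :=
  2^-1 *: \sum_(b : posroot n) posroot_vec R b.

(* The inverse makes this the left action with s (e_k) = e_(s k). *)
Definition weyl_act (R : realType) (n : nat) (s : 'S_n.+1)
  (v : 'rV[R]_n.+1) : 'rV[R]_n.+1 := col_perm s^-1%g v.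

Definition vector_partitions (R : realType) (n : nat) (xi : 'rV[R]_n.+1) :
  set {ffun posroot n -> nat} :=
  [set c : {ffun posroot n -> nat} |
    \sum_(b : posroot n) posroot_vec R b *+ c b = xi]%classic.

(* [fset_set] sends infinite sets to the empty one, but never does so here:
   see [finite_vector_partitions]. *)
Definition kostant (R : realType) (n : nat) (xi : 'rV[R]_n.+1) : nat :=
  #|` fset_set (vector_partitions xi)|.

Definition weyl_alternation (R : realType) (n : nat)
  (lambda mu : 'rV[R]_n.+1) : {set 'S_n.+1} :=
  [set s : 'S_n.+1 |
    (0 < kostant (weyl_act s (lambda + rho R n) - mu - rho R n))%N].

Lemma root_sumE (R : realType) (n i j : nat) : (i <= j)%N ->
  root_sum R n i j = stdvec R n i - stdvec R n j.+1.
Proof.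
move=> ij; apply: oppr_inj; rewrite /root_sum -sumrN opprB.
under eq_bigr do rewrite opprB.
by rewrite telescope_sumr// leqW.
Qed.

Lemma finite_vector_partitions (R : realType) (n : nat) (xi : 'rV[R]_n.+1) :
  finite_set (vector_partitions xi).
Proof.
pose h (v : 'rV[R]_n.+1) : R := - \sum_m v 0 m *+ m.+1.
have hD u v : h (u + v) = h u + h v.
  by rewrite /h -opprD -big_split; congr (- _); apply: eq_bigr => m _;
     rewrite mxE mulrnDl.
have h0 : h 0 = 0 by rewrite /h big1 ?oppr0// => m _; rewrite mxE mul0rn.
have hMn v k : h (v *+ k) = h v *+ k.
  by elim: k => [|k IH]; rewrite ?mulr0n// !mulrS hD IH.
have he k : (0 < k <= n.+1)%N -> h (stdvec R n k) = - k%:R.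
  case: k => // k /= kn; rewrite /h (bigD1 (Ordinal kn)) //= big1 ?addr0.
    by rewrite mxE eqxx.
  by move=> m; rewrite mxE eqSS -val_eqE /= => /negbTE ->; rewrite mul0rn.
have hr (b : posroot n) : 1 <= h (posroot_vec R b).
  rewrite /posroot_vec; case: (val b) (valP b) => i j /= /andP[i0 ij].
  rewrite root_sumE//.
  have hN v : h (- v) = - h v by apply/eqP; rewrite -addr_eq0 -hD addNr h0.
  rewrite hD hN he; last by rewrite i0 ltnW.
  rewrite he; last by rewrite ltn_ord.
  by rewrite opprK addrC -natrB ?ler1n ?subn_gt0// leqW.
have [N hN] : exists N : nat, h xi < N%:R.
  exists (Num.bound `|h xi|); apply: le_lt_trans (ler_norm _) _.
  exact: archi_boundP.
pose g (f : {ffun posroot n -> 'I_N.+1}) : {ffun posroot n -> nat} :=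
  [ffun b => val (f b)].
apply: (sub_finite_set (B := (range g))); last exact/finite_image/finite_finset.
move=> c /= cxi.
have cN b : (c b < N.+1)%N.
  rewrite ltnS ltnW // -(ltr_nat R); apply: le_lt_trans hN.
  rewrite -cxi (big_morph h hD h0) (bigD1 b) //= hMn.
  apply: (@le_trans _ _ (h (posroot_vec R b) *+ c b)).
    by apply: ler_wMn2r; exact: hr.
  rewrite lerDl; apply: sumr_ge0 => b' _; rewrite hMn mulrn_wge0 //.
  exact: le_trans ler01 (hr b').
exists [ffun b => Ordinal (cN b)] => //.
by apply/ffunP => b; rewrite !ffunE.
Qed.

(* Main.v *)
From HB Require Import structures.
Require Import Defs.
From mathcomp Require Import all_boot all_order all_fingroup all_algebra.
From mathcomp Require Import finmap.
From mathcomp Require Import classical_sets cardinality reals zify ring.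

Set Implicit Arguments.
Unset Strict Implicit.
Unset Printing Implicit Defensive.

Import Order.TTheory GRing.Theory Num.Theory.
Local Open Scope ring_scope.

(** Only the prefix sums of a weight matter.  A weight is a nonnegative integer
combination of positive roots exactly when its prefix sums are natural numbers
and its coordinates add up to zero: the prefix sums of [e_i - e_(j+1)] are 0 or
1, and conversely the [k]-th prefix sum serves as coefficient of the simple root
[alpha_k] ([kostant_gt0]).  Up to a constant vector, [rho] is
[(0, -1, ..., -n)], so for [p] the inverse of [s] the [m]-th coordinate of
[s (highest_root + rho) - mu - rho], with [m] counted from 0, is
[m + [p m = 0] - (p m + [p m = n])] plus the coordinate of [alpha_(i,j)].
Hence [s] belongs to the alternation set exactly when the partial sums of
[p m + [p m = n]] are at most those of [m + [p m = 0]], with one extra unit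
allowed between [i] and [j] ([weyl_alternationE]).

The key observation is that [x + [x = n]], for [x <= n], is given by
[bump n], the increasing enumeration of the naturals other than [n].  This
leads to the conditions [prefix_dominated c i j p], where [bump c (p m)]
replaces [p m]; the cap [c = n] gives the alternation set of rank [n], and for
[c = n + 1] the bump does nothing.  Removing the last value [d] of a permutation of [0, ..., n+1]
leaves a permutation [q] of [0, ..., n] whose values are then seen through
[bump d], so this family of conditions is stable under removal.  Beyond [j] no
extra unit is available, and the partial sum before the last position
restricts the last value.
- With cap [n + 1] it must be [d = n + 1], and [q] satisfies the condition of
  the same cap [n + 1] ([prefix_dominated_lift_top]).
- With cap [n + 2] both [d = n] and [d = n + 1] are possible, and [q] satisfies
  the condition of cap [d] ([prefix_dominated_lift_id]).
Starting from rank [m + 2], the first rule leads to permutations of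
[0, ..., m+1] with cap [m + 2]; the second splits these into permutations of
[0, ..., m] with cap [m], counting rank [m], and with cap [m + 1], counting rank
[m + 1] by the first rule again. *)

(** * Kostant's partition function and prefix sums *)

Definition prefix_sum (R : realType) (n k : nat) (v : 'rV[R]_n.+1) : R :=
  \sum_(m < n.+1 | (m < k)%N) v 0 m.

Lemma prefix_sum_is_additive (R : realType) (n k : nat) :
  zmod_morphism (@prefix_sum R n k).
Proof. by move=> u v; rewrite -sumrB; apply: eq_bigr => m _; rewrite !mxE. Qed.

HB.instance Definition _ (R : realType) (n k : nat) :=
  GRing.isZmodMorphism.Build _ _ (@prefix_sum R n k)
    (@prefix_sum_is_additive R n k).

Lemma prefix_sum_inj (R : realType) (n : nat) (u v : 'rV[R]_n.+1) :
  (forall k, (k <= n.+1)%N -> prefix_sum k u = prefix_sum k v) -> u = v.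
Proof.
have coordE (w : 'rV[R]_n.+1) (m : 'I_n.+1) :
    w 0 m = prefix_sum m.+1 w - prefix_sum m w.
  rewrite /prefix_sum (bigD1 m) //= (eq_bigl (fun a : 'I_n.+1 => (a < m)%N)).
    by rewrite addrK.
  by move=> a; rewrite ltnS andbC -ltn_neqAle.
move=> uv; apply/rowP => m; by rewrite !coordE !uv // ltnW.
Qed.

Lemma prefix_sum_stdvec (R : realType) (n k l : nat) : (0 < l <= n.+1)%N ->
  prefix_sum k (stdvec R n l) = (l <= k)%:R.
Proof.
case: l => // l /= ln; rewrite /prefix_sum big_mkcond (bigD1 (Ordinal ln)) //=.
rewrite big1 => [|m]; first by rewrite mxE eqxx addr0; case: ifP.
by rewrite -val_eqE mxE eqSS /= => /negbTE ->; case: ifP.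
Qed.

Lemma prefix_sum_root_sum (R : realType) (n k i j : nat) :
  (0 < i)%N -> (i <= j)%N -> (j <= n)%N ->
  prefix_sum k (root_sum R n i j) = (i <= k <= j)%:R.
Proof.
move=> i0 ij jn; rewrite root_sumE // raddfB /= !prefix_sum_stdvec //; last first.
  by rewrite i0 leqW // (leq_trans ij).
rewrite [(k <= j)%N]leqNgt.
case: (ltnP j k) => /= [jk|_]; last by rewrite subr0 andbT.
by rewrite andbF (leq_trans ij (ltnW jk)) subrr.
Qed.

Lemma kostant_gt0P (R : realType) (n : nat) (xi : 'rV[R]_n.+1) :
  reflect (exists c : {ffun posroot n -> nat},
             \sum_(b : posroot n) posroot_vec R b *+ c b = xi)
          (0 < kostant xi)%N.
Proof.
rewrite cardfs_gt0; apply: (iffP (fset0Pn _)) => [[c]|[c cxi]].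
  rewrite in_fset_set; last exact: finite_vector_partitions.
  by move=> /set_mem; exists c.
exists c; rewrite in_fset_set; last exact: finite_vector_partitions.
exact/mem_set.
Qed.

(** Prefix sums are additive and take values 0 and 1 on positive roots, whence
necessity.  For sufficiency the simple roots are enough, because a weight is
determined by its prefix sums. *)
Lemma kostant_gt0 (R : realType) (n : nat) (xi : 'rV[R]_n.+1) :
  (0 < kostant xi)%N =
  [forall k : 'I_n.+1, prefix_sum k xi \is a Num.nat] &&
  (prefix_sum n.+1 xi == 0).
Proof.
have le_n (b : posroot n) : ((val b).2 <= n)%N by rewrite -ltnS ltn_ord.
have rootE (b : posroot n) k :
    prefix_sum k (posroot_vec R b) = ((val b).1 <= k <= (val b).2)%:R.
  have /andP[b0 ble] := valP b.
  by rewrite prefix_sum_root_sum.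
have combE (c : {ffun posroot n -> nat}) k :
    prefix_sum k (\sum_(b : posroot n) posroot_vec R b *+ c b) =
    \sum_(b : posroot n) ((val b).1 <= k <= (val b).2)%:R *+ c b.
  by rewrite raddf_sum; apply: eq_bigr => b _; rewrite raddfMn /= rootE.
apply/kostant_gt0P/andP => [[c <-]|[/forallP xi_nat /eqP xi0]].
  split; first by apply/forallP => k; rewrite combE rpred_sum // => b _;
    rewrite rpredMn // natr_nat.
  rewrite combE big1 // => b _.
  by rewrite [(n < _)%N]ltnNge le_n andbF mul0rn.
(* The roots with equal indices are the simple ones. *)
exists [ffun b : posroot n => if (val b).1 == (val b).2
  then Num.trunc (prefix_sum (val b).1 xi) else 0%N].
apply: prefix_sum_inj => k; rewrite combE leq_eqVlt => /predU1P[->|kn].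
  rewrite xi0 big1 // => b _.
  by rewrite [(n < _)%N]ltnNge le_n andbF mul0rn.
case: (posnP k) => [->|k0].
  rewrite [RHS]big_pred0 // big1 // => b _.
  by have /andP[b0 _] := valP b; rewrite leqNgt b0 mul0rn.
have kk : (1 <= (Ordinal kn, Ordinal kn).1 <= (Ordinal kn, Ordinal kn).2)%N.
  by rewrite /= k0 leqnn.
rewrite (bigD1 (exist _ (Ordinal kn, Ordinal kn) kk : posroot n)) //=.
rewrite big1 ?addr0 => [|b bk].
  rewrite ffunE SubK eqxx /= leqnn mulr1n.
  by rewrite truncnK // (xi_nat (Ordinal kn)).
rewrite ffunE; case: eqP => [b12|]; last by rewrite mulr0n.
rewrite -b12 -eqn_leq; case: eqP => [bk1|]; last by rewrite mul0rn.
case/eqP: bk; apply: val_inj; rewrite [LHS]surjective_pairing -b12 /=.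
by have -> : (val b).1 = Ordinal kn by exact: val_inj.
Qed.

(** * The half sum of the positive roots *)

Lemma sum_posroot (R : realType) (n : nat) (F : 'I_n.+1 -> 'I_n.+1 -> R) :
  \sum_(b : posroot n) F (val b).1 (val b).2 =
  \sum_(a < n.+1) \sum_(b < n.+1 | (1 <= a <= b)%N) F a b.
Proof.
rewrite pair_big_dep /=; symmetry.
exact: (big_sub (fun p : 'I_n.+1 * 'I_n.+1 => (1 <= p.1 <= p.2)%N)
  (fun p => F p.1 p.2)).
Qed.

Lemma sum_leq_ord (n m : nat) : (\sum_(a < n.+1) (1 <= a <= m) = minn m n)%N.
Proof.
elim: n => [|n IHn]; first by rewrite big_ord1 minn0.
by rewrite big_ord_recr IHn /=; lia.
Qed.

Lemma sum_ltn_ord (n m : nat) : (\sum_(a < n.+1) (m < a) = n - m)%N.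
Proof.
elim: n => [|n IHn]; first by rewrite big_ord1.
by rewrite big_ord_recr IHn /=; lia.
Qed.

Lemma sum_indicator (R : realType) (n x : nat) (P : pred nat) :
  \sum_(a < n.+1 | P a) (a == x :> nat)%:R = ((x <= n)%N && P x)%:R :> R.
Proof.
under eq_bigr do rewrite mulrb.
rewrite -big_mkcondr.
by rewrite (big_ord1_cond_eq _ (fun=> 1)) ltnS; case: ifP.
Qed.

(** Among the positive roots, [e_(m+1)] occurs [n - m] times with sign plus and
[m] times with sign minus. *)
Lemma rhoE (R : realType) (n : nat) :
  rho R n = \row_(m < n.+1) (2^-1 * n%:R - m%:R).
Proof.
apply/rowP => m; rewrite [RHS]mxE.
have mn : (m <= n)%N by rewrite -ltnS.
rewrite mxE summxE.
have coordE (b : posroot n) : posroot_vec R b 0 m =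
    ((val b).1 == m.+1 :> nat)%:R - ((val b).2 == m :> nat)%:R.
  have /andP[b0 ble] := valP b.
  rewrite /posroot_vec root_sumE // !mxE eqSS ![_ == m.+1]eq_sym.
  by rewrite [nat_of_ord m == _]eq_sym.
under eq_bigr do rewrite coordE.
rewrite sumrB.
rewrite (sum_posroot (fun a b => (a == m.+1 :> nat)%:R)).
rewrite (sum_posroot (fun a b => (b == m :> nat)%:R)).
rewrite (exchange_big_dep xpredT) //=.
under eq_bigr do rewrite (sum_indicator R n m.+1 (fun a => 0 < a <= _)%N).
under [X in _ - X]eq_bigr do rewrite (sum_indicator R n m
  (fun b => 0 < _ <= b)%N).
rewrite -!natr_sum mn /= sum_leq_ord (minn_idPl mn).
rewrite (eq_bigr (fun b : 'I_n.+1 => nat_of_bool (m < b)%N)) => [|b _]; last first.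
  by have := ltn_ord b; lia.
by rewrite sum_ltn_ord natrB //; field.
Qed.

(** * Alternation sets as sets of dominated permutations *)

(** The cap [c] is a parameter so that one condition covers both the alternation
set of rank [n] ([c = n]) and what remains of that of rank [n + 1] after its
forced last value has been removed ([c = n + 1]). *)
Definition prefix_dominated (n c i j : nat) (p : 'S_n.+1) : bool :=
  [forall k : 'I_n.+1, \sum_(a < n.+1 | a < k) bump c (p a) <=
     \sum_(a < n.+1 | a < k) (a + (p a == 0 :> nat)) + (i <= k <= j)]%N.

Lemma sum_prefix_all (n : nat) (F : 'I_n -> nat) :
  (\sum_(a < n | a < n) F a = \sum_(a < n) F a)%N.
Proof. by apply: eq_bigl => a; exact: ltn_ord. Qed.

Lemma sum_bump (n d : nat) :
  (\sum_(x < n) bump d x = \sum_(x < n) x + (n - d))%N.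
Proof.
elim: n => [|n IHn]; first by rewrite !big_ord0.
rewrite !big_ord_recr /= IHn /bump -!addnA.
by congr addn; lia.
Qed.

(** The coordinates of the weight always add up to zero, so that only the
prefix sums below [n + 1] impose a condition. *)
Lemma weyl_alternationE (R : realType) (n i j : nat) (s : 'S_n.+1) :
  (0 < i)%N -> (i <= j)%N -> (j <= n)%N ->
  (s \in weyl_alternation (highest_root R n) (- root_sum R n i j)) =
  prefix_dominated n i j s^-1.
Proof.
move=> i0 ij jn; have n0 : (0 < n)%N by rewrite (leq_trans i0) // (leq_trans ij).
rewrite inE kostant_gt0; set xi := (X in prefix_sum _ X).
set p := (s^-1)%g.
have xiE (m : 'I_n.+1) : xi 0 m = (m + (p m == 0 :> nat))%:R -
    (bump n (p m))%:R + root_sum R n i j 0 m.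
  rewrite /xi /weyl_act opprK rhoE /highest_root (root_sumE _ n n0).
  set mu := root_sum R n i j; rewrite !mxE !eqSS -/p /bump.
  have -> : (n <= p m)%N = (p m == n :> nat).
    by have := ltn_ord (p m); lia.
  by rewrite !natrD; ring.
have prefixE k : prefix_sum k xi =
    (\sum_(m < n.+1 | (m < k)%N) (m + (p m == 0 :> nat)) + (i <= k <= j))%:R -
    (\sum_(m < n.+1 | (m < k)%N) bump n (p m))%:R.
  rewrite /prefix_sum (eq_bigr _ (fun m _ => xiE m)) big_split sumrB /=.
  rewrite -/(prefix_sum k (root_sum R n i j)) prefix_sum_root_sum //.
  by rewrite -!natr_sum natrD addrAC.
have -> : prefix_sum n.+1 xi == 0.
  rewrite prefixE [(n < j)%N]ltnNge jn andbF addn0 subr_eq0 eqr_nat.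
  rewrite !sum_prefix_all big_split /=.
  have sum_perm (F : nat -> nat) :
      (\sum_(a < n.+1) F (p a) = \sum_(x < n.+1) F x)%N.
    by rewrite [RHS](reindex_perm p).
  rewrite (sum_perm (bump n)) (sum_perm (fun x => nat_of_bool (x == 0))).
  by rewrite sum_bump subSnn [X in (_ + X == _)%N]big_ord_recl /=
    [X in (_ + (_ + X) == _)%N]big1.
rewrite andbT; apply: eq_forallb => k; rewrite prefixE.
apply/idP/idP => [/natr_ge0|le]; first by rewrite subr_ge0 ler_nat.
by rewrite -natrB // natr_nat.
Qed.

Lemma card_weyl_alternation (R : realType) (n i j : nat) :
  (0 < i)%N -> (i <= j)%N -> (j <= n)%N ->
  #|weyl_alternation (highest_root R n) (- root_sum R n i j)| =
  #|[pred p : 'S_n.+1 | prefix_dominated n i j p]|.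
Proof.
move=> i0 ij jn; rewrite -[LHS](fintype.card_image (@invg_inj _)).
apply: eq_card => p; rewrite -{1}(invgK p) fintype.mem_image; last exact: invg_inj.
by rewrite weyl_alternationE // invgK.
Qed.

(** * Removing the last value of a permutation *)

Lemma widen_ord_lift_max (n : nat) (a : 'I_n) :
  widen_ord (leqnSn n) a = lift ord_max a.
Proof. by apply: val_inj; rewrite [RHS]lift_max. Qed.

Lemma forall_ord_recr (n : nat) (P : pred 'I_n.+1) :
  [forall k, P k] =
  [forall k : 'I_n, P (widen_ord (leqnSn n) k)] && P ord_max.
Proof.
apply/forallP/andP => [allP|[/forallP allP Pmax] k].
  by split; [apply/forallP => k; exact: allP | exact: allP].
case: (unliftP ord_max k) => [a ->|-> //].
by rewrite -widen_ord_lift_max; exact: allP.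
Qed.

Lemma sum_prefix_recr (n k : nat) (F : 'I_n.+1 -> nat) : (k <= n)%N ->
  (\sum_(a < n.+1 | a < k) F a = \sum_(a < n | a < k) F (lift ord_max a))%N.
Proof.
move=> kn; rewrite big_mkcond big_ord_recr /= ltnNge kn addn0.
rewrite [RHS]big_mkcond; apply: eq_bigr => a _.
by rewrite widen_ord_lift_max.
Qed.

(** Below the last position the values of the lifted permutation are those of
[q] seen through [bump d].  The prefix of length [n + 1] contains all of them,
so its condition, the second factor, depends on [d] alone. *)
Lemma prefix_dominated_lift (n c i j : nat) (d : 'I_n.+2) (q : 'S_n.+1) :
  (j <= n)%N ->
  prefix_dominated c i j (lift_perm ord_max d q) =
  [forall k : 'I_n.+1, \sum_(a < n.+1 | a < k) bump c (bump d (q a)) <=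
     \sum_(a < n.+1 | a < k) (a + (bump d (q a) == 0)) + (i <= k <= j)]%N &&
  (\sum_(x < n.+1) bump c (bump d x) <= \sum_(x < n.+1) x + (0 < d))%N.
Proof.
move=> jn; rewrite /prefix_dominated forall_ord_recr; congr (_ && _).
  apply: eq_forallb => k; have kn : (k <= n.+1)%N by exact: ltnW.
  rewrite /= !(sum_prefix_recr _ kn).
  congr (_ <= _ + _)%N; apply: eq_bigr => a _;
    by rewrite lift_perm_lift ?lift_max.
rewrite !(sum_prefix_recr _ (leqnn _)) /= [(n.+1 <= j)%N]ltnNge jn andbF addn0.
rewrite !sum_prefix_all [X in (_ <= X)%N]big_split /=.
rewrite [X in (X <= _)%N](reindex_inj (@perm_inj _ q^-1%g)).
rewrite [X in (_ <= _ + X)%N](reindex_inj (@perm_inj _ q^-1%g)) /=.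
congr (_ <= _ + _)%N.
- by apply: eq_bigr => x _; rewrite lift_perm_lift permKV.
- by apply: eq_bigr => x _; exact: lift_max.
under eq_bigr do rewrite lift_perm_lift permKV /=.
rewrite big_ord_recl /= big1 /bump => [|x _].
  by rewrite leqn0; case: (d : nat).
by rewrite /= addnS.
Qed.

(** The cap [n + 2] exceeds all values, so the bump by [d] is the only one left
and plays the role of the cap for [q].  It raises the sum of all values by
[n + 1 - d], while at most one unit is available; this leaves [d = n] and
[d = n + 1].  Positivity of [n] keeps 0 among the values before the last. *)
Lemma prefix_dominated_lift_id (n i j : nat) (d : 'I_n.+2) (q : 'S_n.+1) :
  (0 < n)%N -> (j <= n)%N ->
  prefix_dominated n.+2 i j (lift_perm ord_max d q) =
  (n <= d)%N && prefix_dominated d i j q.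
Proof.
move=> n0 jn; rewrite prefix_dominated_lift // andbC.
have bumpN (x : 'I_n.+1) : bump n.+2 (bump d x) = bump d x.
  by have := ltn_ord x; rewrite /bump; lia.
under eq_bigr do rewrite bumpN.
have -> : (\sum_(x < n.+1) bump d x <= \sum_(x < n.+1) x + (0 < d))%N
    = (n <= d)%N.
  by rewrite sum_bump; have := ltn_ord d; lia.
case: leqP => //= nd; apply: eq_forallb => k.
congr (_ <= _ + _)%N; apply: eq_bigr => a _ //.
by rewrite /bump; congr addn; congr nat_of_bool; lia.
Qed.

(** If the value [n + 1] occurred before the last position, both the cap and the
bump by [d] would raise the sum of all values, and at most one unit is
available.  Hence it comes last, and removing it brings all values below the cap. *)
Lemma prefix_dominated_lift_top (n i j : nat) (d : 'I_n.+2) (q : 'S_n.+1) :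
  (j <= n)%N ->
  prefix_dominated n.+1 i j (lift_perm ord_max d q) =
  (d == ord_max) && prefix_dominated n.+1 i j q.
Proof.
move=> jn; rewrite prefix_dominated_lift // andbC; case: eqP => [->|dn] /=.
  have bumpN (x : 'I_n.+1) : bump n.+1 x = x.
    by have := ltn_ord x; rewrite /bump; lia.
  have bumpNN (x : 'I_n.+1) : bump n.+1 (bump n.+1 x) = x by rewrite !bumpN.
  rewrite (eq_bigr _ (fun x _ => bumpNN x)) leq_addr /=.
  apply: eq_forallb => k; congr (_ <= _ + _)%N; apply: eq_bigr => a _.
    by rewrite !bumpN.
  by rewrite bumpN.
have {}dn : (d <= n)%N.
  have := ltn_ord d; rewrite ltnS leq_eqVlt => /predU1P[dE|//].
  by case: dn; apply: val_inj.
apply/negbTE; rewrite negb_and -ltnNge; apply/orP; left.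
apply: (@leq_trans (\sum_(x < n.+1) x + 2)).
  by rewrite ltn_add2l; case: (0 < d)%N.
rewrite !big_ord_recr /= -addnA; apply: leq_add.
  by apply: leq_sum => x _; rewrite /bump; lia.
by rewrite /bump; lia.
Qed.

Lemma lift_perm_bij (n : nat) :
  bijective (fun x : 'I_n.+1 * 'S_n => lift_perm ord_max x.1 x.2).
Proof.
apply: inj_card_bij => [[d q] [d' q'] /= eqp|].
  have eqd : d = d' by rewrite -(lift_perm_id ord_max d q) eqp lift_perm_id.
  rewrite eqd in eqp *; congr pair; apply/permP => a.
  by apply: (@lift_inj _ d'); rewrite -!(lift_perm_lift ord_max) eqp.
by rewrite card_prod !card_Sn card_ord factS.
Qed.

Lemma card_lift_perm (n : nat) (P : pred 'S_n.+1) :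
  #|P| = (\sum_(d < n.+1) #|[pred q | P (lift_perm ord_max d q)]|)%N.
Proof.
rewrite -sum1_card (reindex _ (onW_bij _ (lift_perm_bij n))) /=.
rewrite -(pair_big_dep xpredT (fun d q => P (lift_perm ord_max d q))
  (fun _ _ => 1%N)) /=.
by apply: eq_bigr => d _; rewrite sum1_card.
Qed.

Lemma card_prefix_dominated_top (n i j : nat) : (j <= n)%N ->
  #|[pred p : 'S_n.+2 | prefix_dominated n.+1 i j p]| =
  #|[pred q : 'S_n.+1 | prefix_dominated n.+1 i j q]|.
Proof.
move=> jn; rewrite card_lift_perm big_ord_recr /= big1 ?add0n => [|d _].
  by apply: eq_card => q; rewrite !inE prefix_dominated_lift_top ?eqxx.
apply: eq_card0 => q; rewrite !inE prefix_dominated_lift_top //.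
by rewrite -val_eqE /= ltn_eqF.
Qed.

Lemma card_prefix_dominated_id (n i j : nat) : (0 < n)%N -> (j <= n)%N ->
  #|[pred p : 'S_n.+2 | prefix_dominated n.+2 i j p]| =
  (#|[pred q : 'S_n.+1 | prefix_dominated n.+1 i j q]| +
   #|[pred q : 'S_n.+1 | prefix_dominated n i j q]|)%N.
Proof.
move=> n0 jn; rewrite card_lift_perm !big_ord_recr /= big1 ?add0n => [|d _].
  rewrite addnC; congr addn; apply: eq_card => q;
    by rewrite !inE prefix_dominated_lift_id //= ?leqnn ?leqnSn.
apply: eq_card0 => q; rewrite !inE prefix_dominated_lift_id //=.
by rewrite leqNgt ltn_ord.
Qed.

Lemma card_prefix_dominated_rec (m i j : nat) : (0 < m)%N -> (j <= m)%N ->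
  #|[pred p : 'S_m.+3 | prefix_dominated m.+2 i j p]| =
  (#|[pred p : 'S_m.+2 | prefix_dominated m.+1 i j p]| +
   #|[pred p : 'S_m.+1 | prefix_dominated m i j p]|)%N.
Proof.
move=> m0 jm; rewrite !card_prefix_dominated_top 1?leqW //.
exact: card_prefix_dominated_id.
Qed.

Theorem proposition5p5 (R : realType) (r i j : nat)
  (hr : (3 <= r)%N) (hi : (1 <= i)%N) (hij : (i <= j)%N)
  (hj : (j <= r - 2)%N) :
  #|weyl_alternation (highest_root R r) (- root_sum R r i j)| =
  (#|weyl_alternation (highest_root R (r - 1)) (- root_sum R (r - 1) i j)| +
   #|weyl_alternation (highest_root R (r - 2)) (- root_sum R (r - 2) i j)|)%N.
Proof.
case: r hr hj => [|[|m]] // hr; rewrite subn1 subn2 /= => jm.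
have jm1 := leqW jm; rewrite !card_weyl_alternation ?(leqW jm1) //.
exact: card_prefix_dominated_rec.
Qed.
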